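(* Let $n$ be a positive integer and let $j\in\{1,\dots,2^n-1\}$. Then, as rational functions in $z$, \[ w_{n,j+1}(z)=\frac{1}{2\,[w_{n,j}(z)]+1-w_{n,j}(z)}, \] where $[\,\cdot\,]$ denotes the integer part defined in the context.
   Context: Let $z$ be a variable. A positive linear fractional transformation is an expression $w=\frac{az+b}{cz+d}$ with $a,b,c,d\in\mathbb{N}_0=\{0,1,2,\dots\}$ and $ad-bc\neq0$. Define $\frac{w}{w+1}:=\frac{az+b}{(a+c)z+(b+d)}$ and $w+1:=\frac{(a+c)z+(b+d)}{cz+d}$. The rows are defined recursively. Row $0$ is $(z)$. For $n\ge1$, row $n$ is $(w_{n,1}(z),\dots,w_{n,2^n}(z))$, with $w_{n,2i-1}=\frac{w_{n-1,i}}{w_{n-1,i}+1}$ and $w_{n,2i}=w_{n-1,i}+1$ for $i=1,\dots,2^{n-1}$. For positive linear functions, write $cz+d\preceq az+b$ if $c\le a$ and $d\le b$. Suppose $w=\frac{az+b}{cz+d}$ satisfies $az+b\preceq cz+d$ or $cz+d\preceq az+b$. Its integer part $[w]$ is the largest $q\in\mathbb{N}_0$ such that $qc\le a$ and $qd\le b$. In particular, $[w]=0$ if $az+b\preceq cz+d$ with $az+b\neq cz+d$. For $n\ge1$, every $w_{n,j}$ satisfies this comparability condition. *)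

(* Defs.v *)
From mathcomp Require Import all_boot all_order all_algebra.
Set Implicit Arguments.
Unset Strict Implicit.
Unset Printing Implicit Defensive.
Import GRing.Theory.

(* The expression (a z + b) / (c z + d), kept as an unreduced quadruple;
   a d - b c <> 0 is written without subtraction since the entries are nat. *)
Record plft : Type := Plft {
  pa : nat; pb : nat; pc : nat; pd : nat;
  plft_det : pa * pd != pb * pc }.

Fact plft_z_det : 1 * 1 != 0 * 0. Proof. by []. Qed.
Definition plft_z : plft := Plft plft_z_det.

Fact plft_left_det (w : plft) :
  pa w * (pb w + pd w) != pb w * (pa w + pc w).
Proof. by rewrite !mulnDr (mulnC (pb w) (pa w)) eqn_add2l plft_det. Qed.

(* w / (w + 1) *)
Definition plft_left (w : plft) : plft := Plft (plft_left_det w).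

Fact plft_right_det (w : plft) :
  (pa w + pc w) * pd w != (pb w + pd w) * pc w.
Proof. by rewrite !mulnDl (mulnC (pd w)) eqn_add2r plft_det. Qed.

(* w + 1 *)
Definition plft_right (w : plft) : plft := Plft (plft_right_det w).

(* plft_row n j is w_{n,j}, with j counted from 1; it is only meaningful for
   1 <= j <= 2 ^ n.  Both j = 2 i - 1 and j = 2 i have uphalf j = i. *)
Fixpoint plft_row (n j : nat) : plft :=
  if n is m.+1 then
    let w := plft_row m (uphalf j) in
    if odd j then plft_left w else plft_right w
  else plft_z.

Lemma plft_row_odd (m i : nat) : 0 < i ->
  plft_row m.+1 (2 * i - 1) = plft_left (plft_row m i).
Proof.
case: i => // i _; rewrite mul2n doubleS subn1 /=.
by rewrite odd_double /= doubleK.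
Qed.

Lemma plft_row_even (m i : nat) :
  plft_row m.+1 (2 * i) = plft_right (plft_row m i).
Proof. by rewrite mul2n /= odd_double /= uphalf_double. Qed.

Definition plft_comparable (w : plft) : bool :=
  ((pa w <= pc w) && (pb w <= pd w)) || ((pc w <= pa w) && (pd w <= pb w)).

Lemma plft_row_comparable (n j : nat) :
  0 < n -> plft_comparable (plft_row n j).
Proof.
case: n => // n _; rewrite /plft_comparable /=.
by case: (odd j); rewrite /= ?leq_addl ?leq_addr ?orbT.
Qed.

Definition plft_le_mul (w : plft) (q : nat) : bool :=
  (q * pc w <= pa w) && (q * pd w <= pb w).

Fact plft_le_mul_ex (w : plft) : exists q, plft_le_mul w q.
Proof. by exists 0. Qed.

Fact plft_le_mul_bound (w : plft) (q : nat) :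
  plft_le_mul w q -> q <= pa w + pb w.
Proof.
case: w => a b c d /= det /andP[/= hc hd].
have [c0|c_gt0] := posnP c; last first.
  by apply: leq_trans (leq_addr _ _); apply: leq_trans hc; apply: leq_pmulr.
have d_gt0 : 0 < d by case: d {hd} det => //; rewrite c0 !muln0.
by apply: leq_trans (leq_addl _ _); apply: leq_trans hd; apply: leq_pmulr.
Qed.

(* The integer part [w]: the largest q with q c <= a and q d <= b.  It is
   defined for every w, but is used only where plft_comparable holds. *)
Definition plft_int (w : plft) : nat :=
  ex_maxn (plft_le_mul_ex w) (@plft_le_mul_bound w).

Local Open Scope ring_scope.

(* w as an element of the field Q(z), 'X being the variable z. *)
Definition plft_frac (w : plft) : {fraction {poly rat}} :=
  tofrac ((pa w)%:R *: 'X + (pb w)%:R%:P)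
  / tofrac ((pc w)%:R *: 'X + (pd w)%:R%:P).

(* Main.v *)
Require Import Defs.
From mathcomp Require Import all_boot all_order all_algebra.
From mathcomp Require Import zify ring.
Import GRing.Theory.
Local Open Scope ring_scope.

(** Induction on the row.  Two siblings are [w / (w + 1)], of integer part [0],
    and [w + 1]; for these the formula is [1 / (1 - w / (w + 1)) = w + 1].
    Otherwise the two entries are [w + 1] and [w' / (w' + 1)], where [w], [w']
    are neighbours in the previous row.  Since [[w + 1] = [w] + 1], taking
    inverses in the formula for [w], [w'] and adding [1] gives the claim. *)

Lemma plft_int_spec (w : plft) (q : nat) :
  (forall p, plft_le_mul w p = (p <= q)%N) -> plft_int w = q.
Proof.
move=> hq; rewrite /plft_int; case: ex_maxnP => m; rewrite hq => le_mq max_m.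
by apply/eqP; rewrite eqn_leq le_mq max_m // hq.
Qed.

(** Both defining inequalities are monotone in [q], so the admissible [q] form an initial
    segment. *)
Lemma plft_le_mulE (w : plft) (q : nat) :
  plft_le_mul w q = (q <= plft_int w)%N.
Proof.
rewrite /plft_int; case: ex_maxnP => m /andP[hc hd] max_m.
apply/idP/idP => [/max_m//|le_qm]; apply/andP; split.
  by apply: leq_trans hc; rewrite leq_mul2r le_qm orbT.
by apply: leq_trans hd; rewrite leq_mul2r le_qm orbT.
Qed.

Lemma plft_int_left (w : plft) : plft_int (plft_left w) = 0%N.
Proof.
apply: plft_int_spec => -[|p]; first by rewrite /plft_le_mul.
apply/negbTE/negP => /andP[/= hc hd].
(* A positive multiplier would force [pc w = pd w = 0], so the determinant would vanish. *)
by have := plft_det w; nia.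
Qed.

Lemma plft_int_right (w : plft) : plft_int (plft_right w) = (plft_int w).+1.
Proof.
apply: plft_int_spec => -[|p]; first by rewrite /plft_le_mul.
rewrite ltnS -plft_le_mulE /plft_le_mul /= !mulSn.
by rewrite ![(_ + p * _)%N]addnC !leq_add2r.
Qed.

Definition lin_frac (a b : nat) : {fraction {poly rat}} :=
  tofrac (a%:R *: 'X + b%:R%:P).

Lemma plft_fracE (w : plft) :
  plft_frac w = lin_frac (pa w) (pb w) / lin_frac (pc w) (pd w).
Proof. by []. Qed.

Lemma lin_fracD (a b c d : nat) :
  lin_frac (a + c) (b + d) = lin_frac a b + lin_frac c d.
Proof.
by rewrite /lin_frac -tofracD !natrD scalerDl polyCD addrACA.
Qed.

Lemma lin_frac_neq0 (a b : nat) : (a + b != 0)%N -> lin_frac a b != 0.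
Proof.
move=> ab0; rewrite /lin_frac tofrac_eq0; apply: contra ab0 => /eqP/polyP h.
(* The coefficients of degrees 0 and 1 are [b] and [a]; both vanish in [rat], hence in [nat]. *)
have := h 0%N; have := h 1%N.
rewrite !coefE /= !mulr1 !mulr0 addr0 add0r => /eqP + /eqP.
by rewrite !Num.Theory.pnatr_eq0 => /eqP-> /eqP->.
Qed.

Lemma plft_num_neq0 (w : plft) : lin_frac (pa w) (pb w) != 0.
Proof. by apply: lin_frac_neq0; have := plft_det w; nia. Qed.

Lemma plft_den_neq0 (w : plft) : lin_frac (pc w) (pd w) != 0.
Proof. by apply: lin_frac_neq0; have := plft_det w; nia. Qed.

Lemma plft_frac_right (w : plft) : plft_frac (plft_right w) = plft_frac w + 1.
Proof.
by rewrite !plft_fracE /= lin_fracD mulrDl divff ?plft_den_neq0.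
Qed.

Lemma plft_frac_left_inv (w : plft) :
  (plft_frac (plft_left w))^-1 = 1 + (plft_frac w)^-1.
Proof.
by rewrite !plft_fracE /= lin_fracD !invf_div mulrDl divff ?plft_num_neq0.
Qed.

(* Stated over abstract structures because rewriting concrete expressions in
   [{fraction {poly rat}}] makes unification unfold the polynomials. *)
Lemma one_sub_div_inv (F : fieldType) (x y : F) :
  x + y != 0 -> (1 - x / (x + y))^-1 = (x + y) / y.
Proof.
by move=> xy0; rewrite -{1}(divff xy0) -mulrBl addrAC subrr add0r invf_div.
Qed.

Lemma formula_shift (S : comNzRingType) (k x : S) :
  1 + (2%:R * k + 1 - x) = 2%:R * (k + 1) + 1 - (x + 1).
Proof. by ring. Qed.

Lemma plft_frac_siblings (w : plft) :
  plft_frac (plft_right w) = (1 - plft_frac (plft_left w))^-1.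
Proof.
have xy0 := plft_den_neq0 (plft_left w).
rewrite !plft_fracE /= lin_fracD in xy0 *.
by rewrite one_sub_div_inv.
Qed.

(** The inverted form suits the induction: on a left child, inversion turns [w / (w + 1)] into
    [1 + 1 / w]. *)
Lemma plft_frac_row_next (n j : nat) : (0 < j < 2 ^ n)%N ->
  (plft_frac (plft_row n j.+1))^-1 =
  2%:R * (plft_int (plft_row n j))%:R + 1 - plft_frac (plft_row n j).
Proof.
elim: n j => [|n IHn] j; first by case: j.
case: (boolP (odd j)) => [odd_j _ | even_j lt_j].
  rewrite /= odd_j /= plft_int_left mulr0 add0r.
  (* For odd [j], entries [j] and [j.+1] have the same parent. *)
  have -> : (j./2).+1 = uphalf j by lia.
  by rewrite plft_frac_siblings invrK.
rewrite /= even_j (negbTE even_j) /=.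
(* For even [j], the parents are consecutive entries of row [n]. *)
have -> : (j./2).+1 = (uphalf j).+1 by lia.
rewrite plft_frac_left_inv IHn; last by rewrite expnS in lt_j; lia.
by rewrite plft_int_right plft_frac_right -(natr1 (plft_int _)) formula_shift.
Qed.

Theorem mainTheorem8 (n j : nat) (hn : (0 < n)%N)
    (hj : (1 <= j <= 2 ^ n - 1)%N) :
  plft_frac (plft_row n j.+1) =
  1 / (2%:R * (plft_int (plft_row n j))%:R + 1 - plft_frac (plft_row n j)).
Proof.
by rewrite -plft_frac_row_next ?div1r ?invrK //; lia.
Qed.
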